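(* Let $\ell\ne p$ be a prime and let $e_i$ be the multiplicity of $\ell^i$ as an elementary divisor of the adjacency matrix $A$ of the skew-lines graph $\Gamma$ on the $2$-dimensional subspaces of $V=\mathbb F_q^n$ ($n\ge4$, $q=p^t$). Put $f=[n]-1$ and $g=\left[\begin{smallmatrix}n\\2\end{smallmatrix}\right]_q-[n]$. In each case below, $e_i=0$ for all $i$ not listed. (A) Suppose $\ell\nmid q+1$. If $\ell\nmid[n-2]$ and $\ell\nmid[n-3]$, then $\ell\nmid|S(\Gamma)|$. Otherwise: (i) if $\ell\mid[n-2]$ and $\ell\nmid[n-3]$, with $a=v_\ell\left(\left[\begin{smallmatrix}n-2\\2\end{smallmatrix}\right]_q\right)$: $e_a=1$, $e_0=f+g$; (ii) if $\ell\nmid[n-2]$ and $\ell\mid[n-3]$, with $a=v_\ell([n-3])$: $e_a=f+1$, $e_0=g$. (B) Suppose $\ell\mid q+1$. (i) If $\ell\mid[n-2]$ (so $n$ is even) and $\ell\nmid[(n-2)/2]_{q^2}$, then $\ell\nmid|S(\Gamma)|$. (ii) If $\ell\mid[n-2]$ and $\ell\mid[(n-2)/2]_{q^2}$, with $a=v_\ell\left(\left[\begin{smallmatrix}n-2\\2\end{smallmatrix}\right]_q\right)$: $e_a=1$, $e_0=f+g$. (iii) If $\ell\mid[n-3]$ (so $n$ is odd) and $\ell\nmid[(n-3)/2]_{q^2}$, with $a=v_\ell([n-3])$: $e_a=f$, $e_0=g+1$. (iv) If $\ell\mid[n-3]$ and $\ell\mid[(n-3)/2]_{q^2}$, with $a=v_\ell(q+1)$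 and $b=v_\ell\left(\frac{[n-3]}{q+1}\right)$: $e_{a+b}=f$, $e_b=1$, $e_0=g$.
   Context: Let $p$ be a prime, $q=p^t$ with $t\ge1$, $n\ge4$, and $V$ an $n$-dimensional vector space over $\mathbb F_q$. Notation: $[m]=\frac{q^m-1}{q-1}$, $[m]_{q^2}=\frac{q^{2m}-1}{q^2-1}$, and $\left[\begin{smallmatrix}m\\k\end{smallmatrix}\right]_q$ is the number of $k$-dimensional subspaces of $\mathbb F_q^m$; $v_\ell$ is the $\ell$-adic valuation. The skew-lines graph $\Gamma$ has as vertices the $2$-dimensional subspaces of $V$, two being adjacent when their intersection is $\{0\}$; $A$ is its adjacency matrix. The Smith group $S(\Gamma)$ is the (finite) cokernel of $A$ over $\mathbb Z$. The multiplicity of $\ell^i$ as an elementary divisor of an integer matrix is the number of nonzero diagonal entries of its Smith normal form whose $\ell$-adic valuation is exactly $i$. *)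

(* Defs.v *)
From HB Require Import structures.
From mathcomp Require Import all_boot all_order all_algebra all_field.
From mathcomp Require Import finmap boolp classical_sets functions cardinality.

Set Implicit Arguments.
Unset Strict Implicit.
Unset Printing Implicit Defensive.

Import GRing.Theory VectorInternalTheory.
Local Open Scope ring_scope.

(* Over a finite field there are finitely many subspaces; a subspace is stored
   as a canonical matrix, and the instance is inherited from matrices. *)
HB.instance Definition _ (F : finFieldType) (V : vectType F) :=
  [Countable of {vspace V} by <:].
HB.instance Definition _ (F : finFieldType) (V : vectType F) :=
  [Finite of {vspace V} by <:].

(* (q ^ m - 1) / (q - 1); the division is exact for q > 1. *)
Definition qint (q m : nat) : nat := ((q ^ m - 1) %/ (q - 1))%N.

(* The number of k-dimensional subspaces of F ^ m. *)
Definition gauss_binom (F : finFieldType) (m k : nat) : nat :=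
  #|[set U : {vspace 'rV[F]_m} | \dim U == k]|.

Definition line (F : finFieldType) (V : vectType F) : predArgType :=
  {U : {vspace V} | \dim U == 2%N}.
HB.instance Definition _ (F : finFieldType) (V : vectType F) :=
  Finite.on (line V).

(* As a line U satisfies U :&: U = U != 0, this relation is irreflexive. *)
Definition skew_lines (F : finFieldType) (V : vectType F) : rel (line V) :=
  fun U W => (val U :&: val W == 0)%VS.

Definition adjacency_mx (T : finType) (e : rel T) : 'M[int]_#|T| :=
  \matrix_(i, j) (e (enum_val i) (enum_val j))%:R.

Definition skew_lines_mx (F : finFieldType) (V : vectType F) :
    'M[int]_#|line V| :=
  adjacency_mx (@skew_lines F V).

Definition colspan_int (n : nat) (A : 'M[int]_n) : {pred 'cV[int]_n} :=
  fun v => `[< exists w : 'cV[int]_n, v = A *m w >].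

Lemma colspan_int_zmod_closed (n : nat) (A : 'M[int]_n) :
  zmod_closed (colspan_int A).
Proof.
split; first by apply/asboolP; exists 0; rewrite mulmx0.
move=> u v /asboolP[x ->] /asboolP[y ->]; apply/asboolP.
by exists (x - y); rewrite mulmxBr.
Qed.

HB.instance Definition _ (n : nat) (A : 'M[int]_n) :=
  GRing.isZmodClosed.Build _ (colspan_int A) (colspan_int_zmod_closed A).

Definition smith_group (n : nat) (A : 'M[int]_n) : zmodType :=
  Quotient.quot (colspan_int A).

(* By the convention of fset_set the order of an infinite group is 0; hence an
   order prime to l entails finiteness. *)
Definition smith_group_order (n : nat) (A : 'M[int]_n) : nat :=
  #|` fset_set [set: smith_group A]%classic|.

(* d is the diagonal of a Smith normal form of A. The entries are normalized
   only up to sign, as in int_Smith_normal_form. *)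
Definition smith_diag (n : nat) (A : 'M[int]_n) (d : 'rV[int]_n) : Prop :=
  (forall i j : 'I_n, (i <= j)%N -> (d ord0 i %| d ord0 j)%Z) /\
  exists L R : 'M[int]_n,
    [/\ L \in unitmx, R \in unitmx & A = L *m diag_mx d *m R].

Lemma smith_diag_exists (n : nat) (A : 'M[int]_n) : exists d, smith_diag A d.
Proof.
have [L Lu [R Ru [s ss AE]]] := int_Smith_normal_form A.
exists (\row_i s`_i); split.
  move=> i j ij; rewrite !mxE.
  have [js|js] := ltnP j (size s); last by rewrite (nth_default _ js) dvdz0.
  apply: (sorted_leq_nth dvdz_trans dvdzz) => //.
  by rewrite inE (leq_ltn_trans ij).
exists L, R; split=> //; rewrite AE; congr (_ *m _ *m _).
by apply/matrixP => i j; rewrite !mxE.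
Qed.

(* The multiplicity of l ^ i as an elementary divisor, read off from the
   diagonal of a Smith normal form. *)
Definition elementary_mult (n : nat) (d : 'rV[int]_n) (l i : nat) : nat :=
  #|[set j : 'I_n | (d ord0 j != 0) && (logn l `|d ord0 j|%N == i)]|.

(* Main.v *)
(* Work locally at l; let M be the point-line incidence matrix, J an all-one matrix,
   c = q^2 [n-3] and k = q^4 [n-2 choose 2]_q. Counting common points gives
   A = q I + J - M^T M and M M^T = J + q [n-2] I, whence M A = c (J - M),
   A M^T = c (J - M^T) and A 1 = k 1. For integer matrices K such that l^i
   divides K A, the largest possible rank of K mod l is the number kappa_i of
   Smith diagonal entries divisible by l^i, and the multiplicity of l^i is
   kappa_i - kappa_(i+1). Lower bounds for kappa_i come from the rows of M,
   their differences and the all-one row. Conversely, if K A = 0 mod l^i with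
   i >= 1 and s = K 1, the identities give q K = (K M^T) M - s 1^T mod l,
   s = 0 mod l unless l^i divides k, and K M^T = s 1^T mod l unless l^i divides
   c; as q is a unit mod l, this confines K mod l to a small row space. *)

From HB Require Import structures.
Require Import Defs.
From mathcomp Require Import finmap boolp classical_sets cardinality.
From mathcomp Require Import all_boot all_order all_algebra all_field.
From mathcomp Require Import ring zify.

Set Implicit Arguments.
Unset Strict Implicit.
Unset Printing Implicit Defensive.

Import GRing.Theory.
Local Open Scope ring_scope.

(** * Smith diagonal entries divisible by a given integer *)

Definition dvd_count (n : nat) (d : 'rV[int]_n) (x : int) : nat :=
  #|[set j : 'I_n | (x %| d ord0 j)%Z]|.

(** Zero entries of [d] are counted in both [dvd_count] terms and cancel; the difference comes from
    nonzero entries of valuation exactly [i]. *)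
Lemma elementary_mult_dvd_count n (d : 'rV[int]_n) l i : prime l ->
  (elementary_mult d l i + dvd_count d (l ^ i.+1)%N =
   dvd_count d (l ^ i)%N)%N.
Proof.
move=> lP; rewrite /elementary_mult /dvd_count -cardsUI.
rewrite [X in (_ + X)%N](_ : _ = 0%N) ?addn0; last first.
  apply/eqP; rewrite cards_eq0 -subset0; apply/subsetP => j; rewrite !inE.
  case/andP=> /andP[d0 /eqP e]; rewrite dvdzE /= pfactor_dvdn ?absz_gt0 // e.
  by rewrite ltnn.
congr #|pred_of_set _|; apply/setP => j; rewrite !inE !dvdzE /=.
have [->|d0] := eqVneq (d ord0 j) 0; first by rewrite !dvdn0.
by rewrite !pfactor_dvdn ?absz_gt0 //= eq_sym -leq_eqVlt.
Qed.

Lemma dvdz_prime_pow l i (a b : int) : prime l -> ((l ^ i)%N%:Z %| a * b)%Z ->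
  ~~ ((l ^ i)%N%:Z %| a)%Z -> (l%:Z %| b)%Z.
Proof.
move=> lP; rewrite !dvdzE abszM /= => dab; apply: contraR => ndb.
have co : coprime (l ^ i) `|b|%N by rewrite coprimeXl // prime_coprime.
by rewrite Gauss_dvdl in dab.
Qed.

(** * Reduction of integer matrices modulo l *)

Section ResidueMatrix.
Variables (l : nat) (lP : prime l).

Definition resmx m n (A : 'M[int]_(m, n)) : 'M['F_l]_(m, n) :=
  map_mx intr A.

Lemma intr_Fp_eq0 (x : int) : (x%:~R == 0 :> 'F_l) = (l%:Z %| x)%Z.
Proof. by rewrite -(dvdz_pcharf (pchar_Fp lP)). Qed.

Lemma dvd_mxP m n (x : int) (A : 'M[int]_(m, n)) :
  (forall i j, (x %| A i j)%Z) -> exists B, A = x *: B.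
Proof.
move=> dA; exists (\matrix_(i, j) (A i j %/ x)%Z); apply/matrixP => i j.
by rewrite !mxE mulrC divzK.
Qed.

Lemma resmx_unit n (A : 'M[int]_n) : A \in unitmx -> resmx A \in unitmx.
Proof. by rewrite !unitmxE det_map_mx; apply: rmorph_unit. Qed.

Lemma resmxM m n p (A : 'M[int]_(m, n)) (B : 'M_(n, p)) :
  resmx (A *m B) = resmx A *m resmx B.
Proof. exact: map_mxM. Qed.

Lemma resmxD m n (A B : 'M[int]_(m, n)) : resmx (A + B) = resmx A + resmx B.
Proof. exact: map_mxD. Qed.

Lemma resmxB m n (A B : 'M[int]_(m, n)) : resmx (A - B) = resmx A - resmx B.
Proof. exact: map_mxB. Qed.

Lemma resmxZ m n (a : int) (A : 'M[int]_(m, n)) :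
  resmx (a *: A) = a%:~R *: resmx A.
Proof. exact: map_mxZ. Qed.

Lemma resmx_const m n (a : int) :
  resmx (const_mx a) = const_mx a%:~R :> 'M_(m, n).
Proof. exact: map_const_mx. Qed.

Lemma resmx_scalar n (a : int) : resmx a%:M = a%:~R%:M :> 'M_n.
Proof. exact: map_scalar_mx. Qed.

Lemma resmx_tr m n (A : 'M[int]_(m, n)) : resmx A^T = (resmx A)^T.
Proof. by rewrite [RHS]map_trmx. Qed.

Lemma resmx_scale_eq0 m n (x : int) (A : 'M[int]_(m, n)) :
  (l%:Z %| x)%Z -> resmx (x *: A) = 0.
Proof.
rewrite -intr_Fp_eq0 => /eqP x0; apply/matrixP => i j.
by rewrite !mxE rmorphM /= x0 mul0r.
Qed.

(** Entrywise, [x] lacks at least one factor l of l^i, which [A] must supply. This brings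
    divisibility by l^i down to vanishing mod l. *)
Lemma resmx_cancel m n i (x : int) (A B : 'M[int]_(m, n)) :
  ~~ ((l ^ i)%N%:Z %| x)%Z -> x *: A = (l ^ i)%N%:Z *: B -> resmx A = 0.
Proof.
move=> nx eAB; apply/matrixP => r s; rewrite !mxE; apply/eqP.
rewrite intr_Fp_eq0; apply: (dvdz_prime_pow lP _ nx).
by have := congr1 (fun C : 'M_(_, _) => C r s) eAB; rewrite !mxE => ->;
  apply: dvdz_mulr.
Qed.

End ResidueMatrix.

(** * Rank of diagonal 0-1 matrices *)

Section IndicatorRank.
Variables (F : fieldType) (n : nat).

Definition diag_ind (I : {set 'I_n}) : 'M[F]_n :=
  diag_mx (\row_j (j \in I)%:R).

Lemma mxrank_diag_ind_le I : (\rank (diag_ind I) <= #|I|)%N.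
Proof.
rewrite /diag_ind diag_mx_sum_delta.
rewrite (bigID (mem I)) /= [X in _ + X]big1 ?addr0; last first.
  by move=> i /negPf iI; rewrite mxE iI scale0r.
have -> : #|I| = (\sum_(i in I) 1)%N by rewrite sum1_card.
elim/big_rec2: _ => [|i k B iI IH]; first by rewrite mxrank0.
apply: leq_trans (mxrank_add _ _) _; apply: leq_add => //.
by rewrite mxE iI scale1r mxrank_delta.
Qed.

Lemma mxrank_diag_ind I : \rank (diag_ind I) = #|I|.
Proof.
apply/eqP; rewrite eqn_leq mxrank_diag_ind_le /=.
(* Lower bound by subadditivity: the indicators of [I] and of its complement add up to the identity,
   of rank [n]. *)
have e1 : diag_ind I + diag_ind (~: I) = 1%:M.
  apply/matrixP => i j; rewrite !mxE inE; case: (i == j); last by rewrite addr0.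
  by case: (_ \in _); rewrite ?add0r ?addr0.
have := mxrank_add (diag_ind I) (diag_ind (~: I)).
rewrite e1 mxrank1 -{1}(card_ord n) -(cardsC I) => h.
rewrite -(leq_add2r #|~: I|); apply: leq_trans h _.
by rewrite leq_add2l mxrank_diag_ind_le.
Qed.

End IndicatorRank.

(** * Divisibility counts as ranks modulo l *)

Section SmithLocal.
Variables (l : nat) (lP : prime l) (n : nat) (A : 'M[int]_n) (d : 'rV[int]_n).
Hypothesis (dA : smith_diag A d).

(** [K *m L] has the same rank mod l as [K]. Its column [s] times [d ord0 s] is divisible by l^i, so
    the column vanishes mod l unless l^i divides that entry. *)
Lemma rank_le_dvd_count m i (K : 'M[int]_(m, n)) B :
  K *m A = (l ^ i)%N%:Z *: B ->
  (\rank (resmx l K) <= dvd_count d (l ^ i)%N)%N.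
Proof.
case: dA => _ [L [R [Lu Ru AE]]] eK.
have {}eK : (K *m L) *m diag_mx d = (l ^ i)%N%:Z *: (B *m invmx R).
  by rewrite scalemxAl -eK AE !mulmxA mulmxK.
set I := [set j : 'I_n | ((l ^ i)%N %| d ord0 j)%Z].
have -> : \rank (resmx l K) = \rank (resmx l (K *m L)).
  by rewrite resmxM mxrankMfree // row_free_unit resmx_unit.
have -> : resmx l (K *m L) = resmx l (K *m L) *m diag_ind _ I.
  apply/matrixP => r s; rewrite mul_mx_diag !mxE inE.
  case: (boolP (_ %| _)%Z) => dj; first by rewrite mulr1.
  rewrite mulr0; apply/eqP; rewrite intr_Fp_eq0 //.
  apply: (@dvdz_prime_pow l i (d ord0 s)) => //.
  have := congr1 (fun C : 'M_(_, _) => C r s) eK; rewrite mul_mx_diag !mxE.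
  by rewrite mulrC => ->; apply: dvdz_mulr.
by rewrite /dvd_count -(mxrank_diag_ind 'F_l) mxrankM_maxr.
Qed.

(** The bound is attained by the rows of [invmx L] at the indices in [I], the other rows being
    replaced by zero. *)
Lemma dvd_count_witness i : exists (K B : 'M[int]_n),
  K *m A = (l ^ i)%N%:Z *: B /\ \rank (resmx l K) = dvd_count d (l ^ i)%N.
Proof.
case: dA => _ [L [R [Lu Ru AE]]].
set I := [set j : 'I_n | ((l ^ i)%N %| d ord0 j)%Z].
pose E : 'M[int]_n := diag_mx (\row_j (j \in I)%:R).
have [B eB] : exists B, E *m diag_mx d = (l ^ i)%N%:Z *: B.
  apply: dvd_mxP => r s; rewrite mul_mx_diag !mxE inE.
  have [rs|_] := eqVneq r s; last by rewrite mulr0n mul0r dvdz0.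
  rewrite rs mulr1n; case: (boolP ((l ^ i)%N %| d ord0 s)%Z) => ds.
    by rewrite mul1r.
  by rewrite mul0r dvdz0.
exists (E *m invmx L), (B *m R); split.
  by rewrite AE !mulmxA mulmxKV // eB scalemxAl.
rewrite resmxM mxrankMfree ?row_free_unit ?resmx_unit ?unitmx_inv //.
rewrite /dvd_count -(mxrank_diag_ind 'F_l); congr (\rank _).
by apply/matrixP => r s; rewrite !mxE rmorphMn /= rmorph_nat.
Qed.

End SmithLocal.

(** * Algebra of an abstract incidence matrix modulo l^i *)

Section IncidenceAlgebra.
Variables (m N : nat) (M : 'M[int]_(m, N)) (Q x : int).
(** In the application [Q] is q and [x] is [n-3], so [a2] is [n-2] and [a1] is [n-1]; [k] is the row
    sum of [A]. *)
Let a2 : int := 1 + Q * x.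
Let a1 : int := 1 + Q * a2.
Let c : int := Q ^+ 2 * x.
Let k : int := Q - a1 * (Q + 1) + N%:R.
Let A : 'M[int]_N := Q%:M + const_mx 1 - M^T *m M.
Hypothesis col_sum : forall j, \sum_i M i j = Q + 1.
Hypothesis row_sum : forall i, \sum_j M i j = a1.
Hypothesis mulMMt : M *m M^T = const_mx 1 + (Q * a2)%:M.

Lemma const_mul_incidence p (a : int) :
  const_mx a *m M = const_mx (a * (Q + 1)) :> 'M_(p, N).
Proof.
apply/matrixP => i j; rewrite !mxE -(col_sum j) mulr_sumr.
by apply: eq_bigr => u _; rewrite mxE.
Qed.

Lemma incidence_mul_const p (a : int) :
  M *m const_mx a = const_mx (a1 * a) :> 'M_(m, p).
Proof.
apply/matrixP => i j; rewrite !mxE -(row_sum i) mulr_suml.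
by apply: eq_bigr => u _; rewrite mxE.
Qed.

Lemma mul_const_mx (R : pzSemiRingType) p r s (a b : R) :
  (const_mx a : 'M_(p, r)) *m (const_mx b : 'M_(r, s)) =
  const_mx (a * b *+ r).
Proof.
apply/matrixP => i j; rewrite !mxE (eq_bigr (fun=> a * b)).
  by rewrite sumr_const card_ord.
by move=> u _; rewrite !mxE.
Qed.

Lemma incidence_mul_adjacency : M *m A = c *: (const_mx 1 - M).
Proof.
rewrite /A mulmxBr mulmxDr mulmxA mulMMt mulmxDl mul_mx_scalar mul_scalar_mx.
rewrite incidence_mul_const const_mul_incidence.
by apply/matrixP => i j; rewrite !mxE /c /a1 /a2; ring.
Qed.

Lemma adjacency_tr : A^T = A.
Proof.
by rewrite /A !linearD linearN /= trmx_mul trmxK tr_scalar_mx trmx_const.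
Qed.

Lemma adjacency_mul_incidence : A *m M^T = c *: (const_mx 1 - M^T).
Proof.
rewrite -[A *m _]trmxK trmx_mul trmxK adjacency_tr incidence_mul_adjacency.
by rewrite linearZ linearB /= trmx_const.
Qed.

Lemma const_mul_adjacency p (a : int) :
  const_mx a *m A = const_mx (a * k) :> 'M_(p, N).
Proof.
rewrite /A mulmxBr mulmxDr mul_mx_scalar mul_const_mx.
have -> : const_mx a *m (M^T *m M) = const_mx (a * a1 * (Q + 1)) :> 'M_(p, N).
  rewrite mulmxA -[const_mx a *m _]trmxK trmx_mul trmxK trmx_const.
  by rewrite incidence_mul_const trmx_const const_mul_incidence [a1 * a]mulrC.
by apply/matrixP => i j; rewrite !mxE -mulr_natr /k; ring.
Qed.

Lemma adjacency_mul_const p (a : int) :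
  A *m const_mx a = const_mx (a * k) :> 'M_(N, p).
Proof.
by rewrite -[A *m _]trmxK trmx_mul adjacency_tr trmx_const const_mul_adjacency
  trmx_const.
Qed.

Variables (l i : nat) (d : 'rV[int]_N).
Hypotheses (lP : prime l) (lQ : ~~ (l%:Z %| Q)%Z) (i_gt0 : (0 < i)%N).
Hypothesis dA : smith_diag A d.
Let li : int := (l ^ i)%N%:Z.
Let dvd_l_li : (l%:Z %| li)%Z.
Proof. by rewrite dvdzE /= dvdn_exp. Qed.
Let Q_neq0 : Q%:~R != 0 :> 'F_l.
Proof. by rewrite intr_Fp_eq0. Qed.

Section Kernel.
Variables (p : nat) (K B : 'M[int]_(p, N)).
Hypothesis KA : K *m A = li *: B.
Let s : 'cV[int]_p := K *m const_mx 1.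

Let mul_const r : K *m const_mx 1 = s *m const_mx 1 :> 'M[int]_(p, r).
Proof.
by rewrite /s -mulmxA mul_const_mx mulr1n mulr1.
Qed.

Lemma kernel_sum : ~~ (li %| k)%Z -> resmx l s = 0.
Proof.
move=> /(resmx_cancel lP); apply.
suff -> : k *: s = K *m (A *m const_mx 1) by rewrite mulmxA KA -scalemxAl.
by rewrite adjacency_mul_const mul1r /s scalemxAr scalemx_const mulr1.
Qed.

(** [K *m (A *m M^T)] is a multiple of l^i and equals [c] times [s *m const_mx 1 - K *m M^T]. *)
Lemma kernel_incidence :
  ~~ (li %| c)%Z -> resmx l (K *m M^T) = resmx l s *m const_mx 1.
Proof.
move=> lc; have : resmx l (s *m const_mx 1 - K *m M^T) = 0.
  apply: (resmx_cancel lP lc).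
  have -> : c *: (s *m const_mx 1 - K *m M^T) = K *m (A *m M^T).
    by rewrite adjacency_mul_incidence -mul_const -scalemxAr mulmxBr.
  by rewrite mulmxA KA -scalemxAl.
rewrite resmxB [resmx l (s *m _)]resmxM resmx_const => /eqP.
by rewrite subr_eq0 => /eqP <-.
Qed.

(** Solve the definition of [A] for the term [Q%:M] and multiply by [K]; the term [K *m A] vanishes
    mod l because [i] is positive. *)
Lemma kernel_span : Q%:~R *: resmx l K =
  resmx l (K *m M^T) *m resmx l M - resmx l s *m const_mx 1.
Proof.
have h : Q *: K = K *m M^T *m M - s *m const_mx 1 + li *: B.
  rewrite -KA -mul_const /A mulmxBr mulmxDr mul_mx_scalar mulmxA.
  by rewrite [RHS]addrC subrKA addrK.
have := congr1 (fun C => resmx l C) h.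
rewrite /= resmxD resmxB resmxZ [resmx l (_ *m M)]resmxM.
by rewrite [resmx l (s *m _)]resmxM resmx_const resmx_scale_eq0 // addr0.
Qed.

Lemma kernel_sub q' (C : 'M['F_l]_(q', N)) :
  (Q%:~R *: resmx l K <= C)%MS -> (resmx l K <= C)%MS.
Proof. by move=> /(submx_trans _) -> //; rewrite eqmx_scale. Qed.

End Kernel.

(** Some [K] attains the count as its rank mod l, so it suffices to enclose its row space. *)
Lemma dvd_count_le q' (C : 'M['F_l]_(q', N)) :
  (forall K B : 'M[int]_N, K *m A = li *: B -> (resmx l K <= C)%MS) ->
  (dvd_count d li <= \rank C)%N.
Proof.
move=> KC; have [K [B [KA <-]]] := dvd_count_witness l dA i.
exact: mxrankS (KC _ _ KA).
Qed.

Lemma const_mul_resmx p :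
  const_mx 1 *m resmx l M = const_mx (Q + 1)%:~R :> 'M['F_l]_(p, N).
Proof.
have := const_mul_incidence p 1; rewrite mul1r => /(congr1 (@resmx l _ _)).
by rewrite resmxM !resmx_const.
Qed.

(* The suffixes _ab say whether l^i divides the eigenvalues -c and k of A. *)
Lemma dvd_count_00 : ~~ (li %| c)%Z -> ~~ (li %| k)%Z -> dvd_count d li = 0%N.
Proof.
move=> lc lk; apply/eqP; rewrite -leqn0.
rewrite -(mxrank0 'F_l N N); apply: dvd_count_le => K B KA.
apply: kernel_sub; rewrite (kernel_span KA) (kernel_incidence KA lc).
by rewrite (kernel_sum KA lk) !mul0mx subr0 submx_refl.
Qed.

(** Both terms of [kernel_span] have rows proportional to the all-one row, since 1^T M = (Q + 1)
    1^T. That row attains the bound, as 1^T A = k 1^T. *)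
Lemma dvd_count_01 : (0 < N)%N ->
  ~~ (li %| c)%Z -> (li %| k)%Z -> dvd_count d li = 1%N.
Proof.
move=> N0 lc /dvdzP[y ky]; apply/eqP; rewrite eqn_leq; apply/andP; split.
  apply: leq_trans (_ : \rank (const_mx 1%R : 'rV['F_l]_N) <= _)%N; last first.
    exact: rank_leq_row.
  apply: dvd_count_le => K B KA; apply: kernel_sub.
  rewrite (kernel_span KA) (kernel_incidence KA lc) -mulmxA.
  rewrite const_mul_resmx -mulmxBr mulmx_sub //.
  have -> : const_mx (Q + 1)%:~R - const_mx 1 =
      Q%:~R *: const_mx 1 :> 'rV['F_l]_N.
    by apply/matrixP => u v; rewrite !mxE rmorphD mulr1 addrK.
  exact: scalemx_sub.
have KA : (const_mx 1 : 'rV_N) *m A = li *: const_mx y.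
  by rewrite const_mul_adjacency mul1r ky mulrC scalemx_const.
apply: leq_trans (rank_le_dvd_count lP dA KA).
rewrite lt0n mxrank_eq0 resmx_const; apply/eqP => /rowP/(_ (Ordinal N0))/eqP.
by rewrite !mxE oner_eq0.
Qed.

(** The column sums [Q + 1] vanish mod l, so the rows of [M] add up to zero. *)
Lemma rank_resmx_incidence_lt : (0 < m)%N ->
  (l%:Z %| Q + 1)%Z -> (\rank (resmx l M) < m)%N.
Proof.
move=> m0 lQ1; rewrite ltn_neqAle rank_leq_row andbT.
apply/negP => /row_freeP[R MR].
have := const_mul_resmx 1; have /eqP -> : (Q + 1)%:~R == 0 :> 'F_l.
  by rewrite intr_Fp_eq0.
move=> /(congr1 (mulmx^~ R)); rewrite -mulmxA MR mulmx1.
move=> /rowP/(_ (Ordinal m0)).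
rewrite !mxE big1 => [/eqP|j _]; last by rewrite !mxE mul0r.
by rewrite oner_eq0.
Qed.

(** * The case where l^i divides c *)

Section DivisibleEigenvalue.
Hypothesis lc : (li %| c)%Z.

(** As [Q] is a unit mod l, the divisor l of [c] divides [x]. Hence [a2] is 1 and [a1] is [Q + 1]
    mod l, and M M^T reduces to J + Q I. *)
Let lx : (l%:Z %| x)%Z.
Proof.
have := dvdz_trans dvd_l_li lc.
by rewrite dvdzE abszM Euclid_dvdM // abszX Euclid_dvdX // andbT -!dvdzE
  (negPf lQ).
Qed.

Let a2_res : a2%:~R = 1 :> 'F_l.
Proof.
rewrite rmorphD rmorphM /=; have /eqP -> : x%:~R == 0 :> 'F_l.
  by rewrite intr_Fp_eq0.
by rewrite mulr0 addr0.
Qed.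

Let a1_res : a1%:~R = (Q + 1)%:~R :> 'F_l.
Proof. by rewrite /a1 rmorphD rmorphM /= a2_res mulr1 rmorphD addrC. Qed.

Let MMt_res : resmx l M *m (resmx l M)^T = const_mx 1 + (Q%:~R)%:M.
Proof.
rewrite -resmx_tr -resmxM mulMMt resmxD resmx_const resmx_scalar.
by rewrite rmorphM /= a2_res mulr1.
Qed.

Let dvd_incidence : exists B, M *m A = li *: B.
Proof.
have /dvdzP[y cy] := lc; exists (y *: (const_mx 1 - M)).
by rewrite incidence_mul_adjacency cy scalerA mulrC.
Qed.

Let mul_const_res p : resmx l M *m const_mx 1 =
  (Q + 1)%:~R *: const_mx 1 :> 'M['F_l]_(m, p).
Proof.
have := congr1 (fun C => resmx l C) (incidence_mul_const p 1); rewrite mulr1 /=.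
by rewrite resmxM !resmx_const a1_res scalemx_const mulr1.
Qed.

(** On vectors of coordinate sum zero, multiplication by [M] mod l is injective: M^T inverts it up
    to the unit [Q]. *)
Let mul_tr_res_inj r (z : 'M['F_l]_(r, m)) :
  z *m const_mx 1 = 0 :> 'M_(r, m) ->
  z *m resmx l M *m (resmx l M)^T = Q%:~R *: z.
Proof.
by move=> z0; rewrite -mulmxA MMt_res mulmxDr z0 add0r mul_mx_scalar.
Qed.

(** The rows of [M] are independent mod l: z M = 0 gives (Q + 1) z 1 = 0, so z has sum zero and
    [mul_tr_res_inj] forces z = 0. *)
Lemma dvd_count_11_ge : ~~ (l%:Z %| Q + 1)%Z -> (m <= dvd_count d li)%N.
Proof.
rewrite -intr_Fp_eq0 // => lQ1; have [B KA] := dvd_incidence.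
apply: leq_trans (rank_le_dvd_count lP dA KA).
suff -> : \rank (resmx l M) = m by [].
apply/eqP; rewrite -/(row_free _) -kermx_eq0; set z := kermx _.
have zM : z *m resmx l M = 0 by apply: mulmx_ker.
have z0 : z *m const_mx 1 = 0 :> 'M_(m, m).
  apply/eqP; have /(congr1 (mulmx z)) := mul_const_res m.
  by rewrite mulmxA zM mul0mx -scalemxAr => /esym/eqP;
    rewrite scalemx_eq0 (negPf lQ1).
have := mul_tr_res_inj z0; rewrite zM mul0mx => /esym/eqP.
by rewrite scalemx_eq0 (negPf Q_neq0).
Qed.

(** With s = 0 mod l, [kernel_span] leaves only the row space of [M], whose rank is below [m] by
    [rank_resmx_incidence_lt]. *)
Lemma dvd_count_10_le : (0 < m)%N -> ~~ (li %| k)%Z ->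
  (l%:Z %| Q + 1)%Z -> (dvd_count d li <= m.-1)%N.
Proof.
move=> m0 lk lQ1; rewrite -ltnS prednK //.
apply: leq_ltn_trans (rank_resmx_incidence_lt m0 lQ1).
apply: dvd_count_le => K B KA; apply: kernel_sub.
by rewrite (kernel_span KA) (kernel_sum KA lk) mul0mx subr0 submxMl.
Qed.

(** The row space of [K] lies in that of [M] plus the all-one row. If l divides [Q + 1], the rows of
    [M] are dependent, which makes room for the extra row; otherwise that row is (Q + 1)^-1 times
    their sum. *)
Lemma dvd_count_11_le : (0 < m)%N -> (dvd_count d li <= m)%N.
Proof.
move=> m0; have [lQ1|lQ1] := boolP (l%:Z %| Q + 1)%Z.
  apply: leq_trans (_ : \rank (resmx l M + (const_mx 1%R : 'rV_N))%MS <= _)%N.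
    apply: dvd_count_le => K B KA; apply: kernel_sub.
    by rewrite (kernel_span KA) addmx_sub_adds ?eqmx_opp ?submxMl.
  apply: leq_trans (mxrank_adds_leqif _ _).1 _.
  apply: leq_trans (leq_add (leqnn _) (rank_leq_row _)) _.
  by rewrite addn1 rank_resmx_incidence_lt.
apply: leq_trans (rank_leq_row (resmx l M)).
apply: dvd_count_le => K B KA; apply: kernel_sub.
rewrite (kernel_span KA) addmx_sub ?submxMl // eqmx_opp mulmx_sub //.
rewrite -(@eqmx_scale _ _ _ (Q + 1)%:~R) ?intr_Fp_eq0 //.
by rewrite scalemx_const mulr1 -const_mul_resmx submxMl.
Qed.

Section PointDifferences.
Variable u0 : 'I_m.
(** Row u of [Z] is the difference of the unit vectors at u and at [u0]. All rows have sum zero, and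
    a rank-one correction gives the identity, so the rank is at least m - 1. *)
Let Z : 'M[int]_m := 1%:M - \matrix_(u, v) (v == u0)%:R.

Let Z_const r : Z *m const_mx 1 = 0 :> 'M_(m, r).
Proof.
apply/matrixP => u v; rewrite mulmxBl mul1mx !mxE (bigD1 u0) //= big1 => [|w].
  by rewrite !mxE eqxx mulr1 addr0 subrr.
by rewrite !mxE => /negPf ->; rewrite mul0r.
Qed.

Let rank_Z : (m.-1 <= \rank (resmx l Z))%N.
Proof.
have := mxrank_add (resmx l Z) (resmx l (\matrix_(u, v) (v == u0)%:R)).
rewrite -resmxD subrK resmx_scalar mxrank1 => /leq_trans h.
rewrite -subn1 leq_subLR addnC; apply: h; rewrite leq_add2l.
suff -> : resmx l (\matrix_(u < m, v < m) (v == u0)%:R) =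
    (const_mx 1 : 'cV_m) *m delta_mx 0 u0.
  by apply: leq_trans (mxrankM_maxr _ _) _; rewrite mxrank_delta.
apply/matrixP => u v; rewrite !mxE big_ord1 !mxE eqxx mul1r /=.
by rewrite rmorph_nat.
Qed.

Let ZM_tr : resmx l (Z *m M) *m (resmx l M)^T = Q%:~R *: resmx l Z.
Proof.
rewrite resmxM; apply: mul_tr_res_inj.
by have /(congr1 (@resmx l _ _)) := Z_const m;
  rewrite resmxM resmx_const => ->; apply/matrixP=> u v; rewrite !mxE.
Qed.

Let rank_ZM : (m.-1 <= \rank (resmx l (Z *m M)))%N.
Proof.
apply: leq_trans (mxrankM_maxl _ (resmx l M)^T).
by rewrite ZM_tr eqmx_scale.
Qed.

(** The all-one part of M A = c (J - M) is killed by [Z]. *)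
Let ZMA : exists B, (Z *m M) *m A = li *: B.
Proof.
have /dvdzP[y cy] := lc; exists (- y *: (Z *m M)).
rewrite -mulmxA incidence_mul_adjacency -scalemxAr mulmxBr Z_const sub0r.
by rewrite cy scalerN scaleNr scalerN scalerA mulrC.
Qed.

Lemma dvd_count_10_ge : (m.-1 <= dvd_count d li)%N.
Proof.
have [B KA] := ZMA.
exact: leq_trans rank_ZM (rank_le_dvd_count lP dA KA).
Qed.

(* For l dividing q + 1 the all-one vector is also killed by the incidence
   matrix, hence is independent of the point differences. *)
Lemma dvd_count_11_ge_succ : (0 < N)%N -> (li %| k)%Z -> (l%:Z %| Q + 1)%Z ->
  (m <= dvd_count d li)%N.
Proof.
move=> N0 /dvdzP[y ky] lQ1; have [B KA] := ZMA.
have KA' : col_mx (Z *m M) (const_mx 1 : 'rV_N) *m A =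
    li *: col_mx B (const_mx y).
  rewrite mul_col_mx KA const_mul_adjacency mul1r scale_col_mx scalemx_const.
  by rewrite ky mulrC.
apply: leq_trans (rank_le_dvd_count lP dA KA').
have -> : resmx l (col_mx (Z *m M) (const_mx 1 : 'rV_N)) =
    col_mx (resmx l (Z *m M)) (const_mx 1).
  by rewrite /resmx map_col_mx map_const_mx.
have /eqP := mxrank_sum_cap (resmx l (Z *m M)) (const_mx 1 : 'rV['F_l]_N).
have -> : (resmx l (Z *m M) :&: (const_mx 1 : 'rV['F_l]_N))%MS = 0.
  apply/eqP; rewrite -submx0; apply/row_subP => u; set v := row u _.
  have : (v <= resmx l (Z *m M) :&: (const_mx 1 : 'rV['F_l]_N))%MS.
    by apply: row_sub.
  rewrite sub_capmx => /andP[/submxP[w vw] /sub_rVP[a va]].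
  (* A common vector times M^T is zero by its all-one form and [Q] times [w *m resmx l Z] by its
     other form. *)
  have : v *m (resmx l M)^T = 0.
    rewrite va -scalemxAl -[const_mx 1 *m _]trmxK trmx_mul trmxK trmx_const.
    rewrite mul_const_res; have /eqP -> : (Q + 1)%:~R == 0 :> 'F_l.
      by rewrite intr_Fp_eq0.
    by rewrite scale0r trmx0 scaler0.
  rewrite vw -mulmxA ZM_tr -scalemxAr => /eqP.
  rewrite scalemx_eq0 (negPf Q_neq0) /=.
  by move=> /eqP wZ; rewrite resmxM mulmxA wZ mul0mx sub0mx.
rewrite mxrank0 addn0 -addsmxE => /eqP ->.
rewrite -[X in (X <= _)%N](ltn_predK (ltn_ord u0)) -addn1.
apply: leq_add rank_ZM _.
rewrite lt0n mxrank_eq0; apply/eqP => /rowP/(_ (Ordinal N0))/eqP.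
by rewrite !mxE oner_eq0.
Qed.

End PointDifferences.

Lemma dvd_count_10 : (0 < m)%N -> ~~ (li %| k)%Z -> (l%:Z %| Q + 1)%Z ->
  dvd_count d li = m.-1.
Proof.
move=> m0 lk lQ1; apply/eqP; rewrite eqn_leq dvd_count_10_le //.
exact: (dvd_count_10_ge (Ordinal m0)).
Qed.

Lemma dvd_count_11 : (0 < m)%N -> (0 < N)%N -> (li %| k)%Z ->
  dvd_count d li = m.
Proof.
move=> m0 N0 lk; apply/eqP; rewrite eqn_leq dvd_count_11_le //=.
have [lQ1|] := boolP (l%:Z %| Q + 1)%Z; last exact: dvd_count_11_ge.
exact: (dvd_count_11_ge_succ (Ordinal m0)).
Qed.

End DivisibleEigenvalue.

End IncidenceAlgebra.

(** * Arithmetic of q-integers *)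

Section QIntegers.
Local Open Scope nat_scope.
Variables (q : nat) (q_gt1 : 1 < q).

Lemma qintE m : qint q m = \sum_(i < m) q ^ i.
Proof. by rewrite /qint !subn1 predn_exp mulKn // -subn1 subn_gt0. Qed.

Lemma qint0 : qint q 0 = 0.
Proof. by rewrite qintE big_ord0. Qed.

Lemma qintS m : qint q m.+1 = 1 + q * qint q m.
Proof.
rewrite !qintE big_ord_recl expn0 big_distrr; congr (_ + _).
by apply: eq_bigr => i _; rewrite expnS.
Qed.

Lemma qintM m : (q - 1) * qint q m = q ^ m - 1.
Proof. by rewrite qintE !subn1 -predn_exp. Qed.

End QIntegers.

Lemma qint_double q m : (1 < q)%N ->
  qint q m.*2 = ((q + 1) * qint (q ^ 2) m)%N.
Proof.
move=> q1; have q2 : (1 < q ^ 2)%N by rewrite -{1}(exp1n 2) ltn_exp2r.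
elim: m => [|m IH]; first by rewrite double0 !qint0 ?muln0.
by rewrite doubleS !qintS // IH; ring.
Qed.

(* Destructing V makes its structure convertible to that of finvect_type V. *)
Lemma card_vspace_finvect (F : finFieldType) (V : vectType F) (U : {vspace V}) :
  #|[pred v : finvect_type V | (v : V) \in U]| = (#|F| ^ \dim U)%N.
Proof.
case: V U => T cT U.
by apply: (@card_vspace F (finvect_type (Vector.Pack cT)) cT U).
Qed.

Lemma dimv_cap_lt (K : fieldType) (V : vectType K) (U W : {vspace V}) :
  U != W -> \dim U = \dim W -> (\dim (U :&: W) < \dim U)%N.
Proof.
move=> UW dUW; rewrite ltn_neqAle dimvS ?capvSl // andbT.
apply: contra UW => /eqP dcap.
have /eqP <- : (U :&: W)%VS == U by rewrite eqEdim capvSl dcap /=.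
by rewrite eqEdim capvSr dcap dUW /=.
Qed.

(** * Counting points and lines of V *)

Section Geometry.
Local Open Scope nat_scope.
Variables (F : finFieldType) (V : vectType F).
Let q := #|F|.
Let n := \dim (fullv : {vspace V}).
Let q_gt1 : 1 < q. Proof. exact: card_finNzRing_gt1. Qed.

Definition point : predArgType := {P : {vspace V} | \dim P == 1}.
HB.instance Definition _ := Finite.on point.

Lemma dim_point (P : point) : \dim (val P) = 1.
Proof. by case: P => U /= /eqP. Qed.

Lemma dim_line (W : line V) : \dim (val W) = 2.
Proof. by case: W => U /= /eqP. Qed.

Lemma card_nonzero (U : {vspace V}) :
  #|[set v : finvect_type V | (v \in U) && (v != 0%R)]| = q ^ \dim U - 1.
Proof.
rewrite -(card_vspace_finvect U).
have -> := cardD1 (0%R : finvect_type V)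
  [pred v : finvect_type V | (v : V) \in U].
have -> : (0%R : V) \in U by apply: mem0v.
by rewrite addKn; apply: eq_card => v; rewrite !inE andbC.
Qed.

Lemma pointP (P : point) (v : V) :
  v != 0%R -> (v \in val P) = (val P == <[v]>%VS).
Proof.
move=> v0; apply/idP/eqP => [vP|->]; last exact: memv_line.
by apply/esym/eqP; rewrite eqEdim -memvE vP dim_vline v0 dim_point.
Qed.

Lemma card_points_on_vector (v : V) : v != 0%R ->
  #|[set P : point | v \in val P]| = 1.
Proof.
move=> v0; have dv : \dim <[v]>%VS == 1 by rewrite dim_vline v0.
apply: etrans (cards1 (Sub <[v]>%VS dv : point)); apply: eq_card => P.
by rewrite !inE pointP // -val_eqE SubK.
Qed.

(** Double count of pairs of a point and a nonzero vector on it: each point holds q - 1 such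
    vectors, and each vector spans one point. *)
Lemma card_points_in (U : {vspace V}) :
  #|[set P : point | (val P <= U)%VS]| = qint q (\dim U).
Proof.
apply/eqP; rewrite -(eqn_pmul2l (_ : 0 < q - 1)) ?subn_gt0 // qintM //.
rewrite -card_nonzero; apply/eqP; rewrite mulnC -sum_nat_const.
transitivity (\sum_(P in [set P : point | (val P <= U)%VS])
   \sum_(v : finvect_type V | (v != 0%R) && (v \in val P)) 1).
  apply: eq_bigr => P _; have := card_nonzero (val P).
  rewrite dim_point expn1 -sum1_card => <-.
  by apply: eq_bigl => v; rewrite inE andbC.
rewrite (exchange_big_dep
  (mem [set v : finvect_type V | (v \in U) && (v != 0%R)])) /=.
  rewrite -sum1_card; apply: eq_bigr => v; rewrite inE => /andP[vU v0].
  rewrite sum1_card; apply: etrans (card_points_on_vector v0).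
  apply: eq_card => P; rewrite inE unfold_in /= inE v0 /=.
  apply: andb_idl => vP; have := pointP P v0; rewrite vP => /esym/eqP ->.
  by rewrite -memvE.
move=> P v; rewrite !inE => /subvP PU /andP[v0 vP].
by rewrite v0 andbT; apply: PU.
Qed.

Lemma card_point : #|point| = qint q n.
Proof.
rewrite -card_points_in -cardsT; apply: eq_card => P.
by rewrite !inE subvf.
Qed.

Lemma card_lines_through2 (P Q : point) : P != Q ->
  #|[set W : line V | (val P <= val W)%VS && (val Q <= val W)%VS]| = 1.
Proof.
move=> PQ; have dPQ : \dim (val P + val Q)%VS == 2.
  have := dimv_sum_cap (val P) (val Q); rewrite !dim_point.
  suff -> : \dim (val P :&: val Q)%VS = 0 by rewrite addn0 => ->.
  apply/eqP; rewrite -leqn0 -ltnS -[X in _ < X](dim_point P).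
  by apply: dimv_cap_lt; rewrite ?dim_point.
apply: etrans (cards1 (Sub (val P + val Q)%VS dPQ : line V)).
apply: eq_card => W.
rewrite !inE -subv_add -val_eqE SubK eq_sym eqEdim.
by rewrite dim_line (eqP dPQ) andbT.
Qed.

Lemma card_points_on (W : line V) :
  #|[set P : point | (val P <= val W)%VS]| = q + 1.
Proof.
rewrite card_points_in dim_line !qintS // qint0 //; ring.
Qed.

(** Count the pairs of a line through [P] and a point [Q] on it. Each line gives q + 1 pairs, the
    choice Q = P gives [r], and the [n] - 1 = q [n-1] other points give one each; hence r q = q
    [n-1]. *)
Lemma card_lines_on (P : point) :
  #|[set W : line V | (val P <= val W)%VS]| = qint q n.-1.
Proof.
have n_gt0 : 0 < n by rewrite -(dim_point P) dimvS ?subvf.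
set r := #|_|.
have : \sum_(Q : point)
    #|[set W : line V | (val P <= val W)%VS && (val Q <= val W)%VS]| =
  r * (q + 1).
  under eq_bigr do rewrite -sum1_card.
  rewrite (exchange_big_dep
    (mem [set W : line V | (val P <= val W)%VS])) /=; last first.
    by move=> Q W _; rewrite !inE => /andP[].
  rewrite -sum_nat_const; apply: eq_bigr => W; rewrite inE => PW.
  rewrite -(card_points_on W) -sum1_card; apply: eq_bigl => Q.
  by rewrite !inE PW.
rewrite (bigD1 P) //= (eq_bigr (fun=> 1)); last first.
  by move=> Q QP; rewrite card_lines_through2 // eq_sym.
have -> : #|[set W : line V | (val P <= val W)%VS && (val P <= val W)%VS]| = r.
  by apply: eq_card => W; rewrite !inE andbb.
have -> : \sum_(Q : point | Q != P) 1 = q * qint q n.-1.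
  have := card_point; rewrite -{1}(prednK n_gt0) qintS // (cardD1 P).
  move=> /addnI <-.
  by rewrite -sum1_card; apply: eq_bigl => Q; rewrite !inE andbT.
rewrite mulnDr muln1 addnC => /addIn/eqP.
by rewrite mulnC eqn_pmul2r 1?ltnW // => /eqP.
Qed.

(** Double count of incident point-line pairs. *)
Lemma card_line : #|line V| * (q + 1) = qint q n * qint q n.-1.
Proof.
rewrite -card_point -[LHS]sum_nat_const -[RHS]sum_nat_const.
transitivity (\sum_(W : line V) \sum_(P : point | (val P <= val W)%VS) 1).
  apply: eq_bigr => W _; rewrite -(card_points_on W) sum1_card.
  by apply: eq_card => P; rewrite inE.
rewrite (exchange_big_dep predT) //=; apply: eq_bigr => P _.
rewrite -(card_lines_on P) sum1_card.
by apply: eq_card => W; rewrite inE.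
Qed.

End Geometry.

(** * The point-line incidence matrix *)

Lemma sum_enum_val_bool (T : finType) (R : pzSemiRingType) (b : pred T) :
  \sum_(i < #|T|) (b (enum_val i))%:R = #|[set x | b x]|%:R :> R.
Proof.
rewrite -(big_enum_val (A := T) (fun x => (b x)%:R)) /= -sum1_card natr_sum.
rewrite [RHS]big_mkcond; apply: eq_bigr => x _; rewrite inE.
by case: (b x).
Qed.

Lemma card_lineE (F : finFieldType) (V : vectType F) :
  #|line V| = #|[set U : {vspace V} | \dim U == 2%N]|.
Proof. by rewrite card_sig; apply: eq_card => U; rewrite !inE. Qed.

Section IncidenceMatrix.
Variables (F : finFieldType) (V : vectType F).
Let q : nat := #|F|.
Let n : nat := \dim (fullv : {vspace V}).
Let q_gt1 : (1 < q)%N. Proof. exact: card_finNzRing_gt1. Qed.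

Definition incidence_mx : 'M[int]_(#|point V|, #|line V|) :=
  \matrix_(i, j) (val (enum_val i) <= val (enum_val j))%VS%:R.

Lemma incidence_col_sum j : \sum_i incidence_mx i j = q%:Z + 1.
Proof.
under eq_bigr do rewrite mxE.
rewrite (sum_enum_val_bool _
  (fun P : point V => (val P <= val (enum_val j))%VS)).
by rewrite card_points_on natrD natz.
Qed.

Lemma incidence_row_sum i : \sum_j incidence_mx i j = (qint q n.-1)%:Z.
Proof.
under eq_bigr do rewrite mxE.
rewrite (sum_enum_val_bool _
  (fun W : line V => (val (enum_val i) <= val W)%VS)).
by rewrite card_lines_on natz.
Qed.

(** Entries count the lines through two points: [n-1] on the diagonal and 1 elsewhere. *)
Lemma incidence_mul_tr :
  incidence_mx *m incidence_mx^T =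
  const_mx 1 + ((qint q n.-1)%:Z - 1)%:M.
Proof.
apply/matrixP => i k; rewrite !mxE.
under eq_bigr do rewrite !mxE -natrM mulnb.
rewrite (sum_enum_val_bool _ (fun W : line V =>
  (val (enum_val i) <= val W)%VS && (val (enum_val k) <= val W)%VS)).
have [<-|ik] := eqVneq i k.
  rewrite mulr1n addrC subrK -(card_lines_on (enum_val i)).
  by rewrite -natz; congr (_%:R); apply: eq_card => W; rewrite !inE andbb.
by rewrite card_lines_through2 ?mulr0n ?addr0 // (inj_eq enum_val_inj).
Qed.

(** An entry of M^T M counts the common points of two lines: q + 1, 1 or 0 as they are equal, meet
    in a point or are skew. *)
Lemma skew_lines_mxE :
  skew_lines_mx V = (q%:Z)%:M + const_mx 1 - incidence_mx^T *m incidence_mx.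
Proof.
apply/matrixP => i j; rewrite !mxE.
under [in RHS]eq_bigr do rewrite !mxE -natrM mulnb.
rewrite (sum_enum_val_bool _ (fun P : point V =>
  (val P <= val (enum_val i))%VS && (val P <= val (enum_val j))%VS)).
set U := enum_val i; set W := enum_val j.
have -> : #|[set P : point V | (val P <= val U)%VS && (val P <= val W)%VS]| =
    qint q (\dim (val U :&: val W)%VS).
  by rewrite -card_points_in; apply: eq_card => P; rewrite !inE subv_cap.
rewrite /skew_lines -dimv_eq0.
have [ij|ij] := eqVneq i j.
  rewrite /U /W ij capvv dim_line !qintS // qint0 //= mulr1n.
  by rewrite muln0 addn0 muln1 natrD; ring.
have : (\dim (val U :&: val W)%VS < 2)%N.
  rewrite -[X in (_ < X)%N](dim_line U).
  by apply: dimv_cap_lt; rewrite ?dim_line // val_eqE (inj_eq enum_val_inj).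
case: (\dim _) => [|[|//]] _; rewrite ?qintS // ?qint0 //=.
by rewrite muln0 addn0 mulr0n add0r subrr.
Qed.

End IncidenceMatrix.

(** * Order of the Smith group *)

Section SmithGroupOrder.
Variables (n : nat) (A : 'M[int]_n) (d : 'rV[int]_n).
Hypothesis dA : smith_diag A d.
Hypothesis d_neq0 : forall j, d 0 j != 0.
Let a (j : 'I_n) : nat := `|d 0%R j|%N.
Let b : nat := \max_j a j.

(** The ranges below [a j] vary with j; the common bound [b] allows them to be cut out of one type
    of functions. *)
Let box : {pred {ffun 'I_n -> 'I_b}} :=
  family (fun j => [pred y : 'I_b | y < a j]%N).

Let card_box : #|box| = (\prod_j a j)%N.
Proof.
rewrite card_family foldrE big_map big_enum /=; apply: eq_bigr => j _.
have ab : (a j <= b)%N by apply: leq_bigmax.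
rewrite -[RHS]card_ord -(card_image (f := widen_ord ab)) => [|x y].
  apply: eq_card => y; apply/idP/imageP => [ya|[x _ ->]].
    by exists (Ordinal ya) => //; apply: val_inj.
  by rewrite unfold_in /=; apply: (ltn_ord x).
by move/(congr1 val) => /= xy; apply: val_inj.
Qed.

(** As [R] is invertible, the column span is L times that of [diag_mx d], so the elements of [box],
    multiplied by [L], represent each coset once. *)
Lemma smith_group_orderE : smith_group_order A = (\prod_j `|d 0%R j|)%N.
Proof.
have [_ [L [R [Lu Ru AE]]]] := dA.
pose phi (h : {ffun 'I_n -> 'I_b}) : smith_group A :=
  \pi_(smith_group A)%qT (L *m \col_j (h j)%:Z).
pose s := [seq phi h | h in box].
(* Every coset is reached by reducing the coordinates of [invmx L *m v] modulo [d]. *)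
have s_full u : u \in s.
  rewrite -[u]reprK; set v := repr u.
  move: (invmx L *m v) (mulKVmx Lu v) => y yv.
  have lt_ya j : (`|(y j 0%R %% d 0%R j)%Z| < a j)%N.
    by rewrite -ltz_nat gez0_abs ?modz_ge0 // abszE ltz_mod.
  have lt_yb j : (`|(y j 0%R %% d 0%R j)%Z| < b)%N.
    by apply: leq_trans (lt_ya j) _; apply: leq_bigmax.
  apply/imageP; exists [ffun j => Ordinal (lt_yb j)].
    by apply/familyP => j; rewrite ffunE inE /=.
  apply/eqP; rewrite -Quotient.idealrBE; apply/asboolP.
  exists (invmx R *m \col_j (y j 0%R %/ d 0%R j)%Z).
  rewrite AE mulmxA mulmxK // -mulmxA -yv -mulmxBr.
  congr (_ *m _); apply/colP => j; rewrite mul_diag_mx !mxE ffunE /=.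
  by rewrite gez0_abs ?modz_ge0 // {1}[y j 0](divz_eq _ (d 0 j)) addrK mulrC.
(* Representatives of one coset agree modulo each diagonal entry and lie below its absolute value,
   hence coincide. *)
have s_uniq : uniq s.
  rewrite map_inj_in_uniq ?enum_uniq // => h h'; rewrite !mem_enum.
  move=> /familyP hb /familyP hb' /eqP; rewrite -Quotient.idealrBE.
  move=> /asboolP[w]; rewrite AE -mulmxBr -!mulmxA.
  move=> /(congr1 (mulmx (invmx L))).
  rewrite !mulKmx // => /colP e; apply/ffunP => j; apply: val_inj => /=.
  have := e j; rewrite mul_diag_mx !mxE => ej.
  have := hb j; have := hb' j; rewrite !unfold_in /= => hj' hj.
  have : ((h j)%:Z = (h' j)%:Z %[mod d 0%R j])%Z.
    by apply/eqP; rewrite eqz_mod_dvd ej dvdz_mulr.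
  by rewrite -[in LHS]modz_abs -[in RHS]modz_abs !modz_small ?ltz_nat // => -[].
rewrite /smith_group_order.
have -> : [set: smith_group A]%classic = [set` [fset u in s]%fset]%classic.
  by apply/seteqP; split=> u //= _; rewrite in_fset s_full.
by rewrite set_fsetK card_fseq undup_id // size_image card_box.
Qed.

End SmithGroupOrder.

Lemma gauss_binom2 (F : finFieldType) m :
  (gauss_binom F m 2 * (#|F| + 1) = qint #|F| m * qint #|F| m.-1)%N.
Proof.
by rewrite /gauss_binom -card_lineE card_line dimvf dim_matrix mul1r.
Qed.

(** Entries prime to l are in particular nonzero, so the order is the product of their absolute
    values. *)
Lemma smith_group_order_prime n (A : 'M[int]_n) (d : 'rV[int]_n) l :
  prime l -> smith_diag A d -> dvd_count d l = 0%N ->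
  ~~ (l %| smith_group_order A)%N.
Proof.
move=> lP dA /eqP; rewrite cards_eq0 => /eqP/setP d0.
have {}d0 j : ~~ (l %| `|d ord0 j|)%N.
  by have := d0 j; rewrite !inE dvdzE /= => ->.
rewrite (smith_group_orderE dA) => [|j].
  elim/big_ind: _ => [|x y lx ly|j _]; last exact: d0.
    by rewrite dvdn1; apply: contraTN lP => /eqP ->.
  by rewrite Euclid_dvdM // negb_or lx.
by apply: contraNneq (d0 j) => ->; rewrite dvdn0.
Qed.

(** * Divisibility counts for the skew-lines matrix *)

Section SkewLines.
Variables (F : finFieldType) (V : vectType F) (r l : nat).
Variable (d : 'rV[int]_#|line V|).
Let q := #|F|.
(** With n = r + 3, [x] is [n-3] and [G] is [n-2 choose 2]_q. *)
Let x := qint q r.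
Let G := gauss_binom F r.+1 2.
Hypotheses (dimV : \dim (fullv : {vspace V}) = r.+3) (r_gt0 : (0 < r)%N).
Hypotheses (lP : prime l) (lq : ~~ (l %| q)%N).
Hypothesis dA : smith_diag (skew_lines_mx V) d.
Let q_gt1 : (1 < q)%N. Proof. exact: card_finNzRing_gt1. Qed.

Lemma qint_gt0 m : (0 < m)%N -> (0 < qint q m)%N.
Proof. by case: m => // m _; rewrite qintS. Qed.

Lemma gauss_binom_mul_succ : (G * (q + 1) = qint q r.+1 * x)%N.
Proof. exact: gauss_binom2. Qed.

Lemma gauss_binom_gt0 : (0 < G)%N.
Proof.
have : (0 < G * (q + 1))%N.
  by rewrite gauss_binom_mul_succ muln_gt0 !qint_gt0.
by rewrite muln_gt0 => /andP[].
Qed.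

Lemma card_line_mul_succ : (#|line V| * (q + 1) = qint q r.+3 * qint q r.+2)%N.
Proof. by rewrite card_line dimV. Qed.

(** It makes the truncated subtraction in [g] exact; the reason is that q + 1 is at most [n-1]. *)
Lemma card_line_ge : (qint q r.+3 <= #|line V|)%N.
Proof.
rewrite -(@leq_pmul2r (q + 1)) ?addn_gt0 ?orbT // card_line_mul_succ.
rewrite leq_mul2l; apply/orP; right; rewrite !qintS // addnC leq_add2l.
by rewrite leq_pmulr.
Qed.

(** Compared after multiplication by q + 1, which turns the number of lines and [G] into polynomials
    in q and [x]. *)
Lemma skew_lines_valency :
  q%:Z - (1 + q%:Z * (1 + q%:Z * x%:Z)) * (q%:Z + 1) + #|line V|%:R =
  (q ^ 4 * G)%N%:Z.
Proof.
apply: (@mulIf _ (q%:Z + 1)); first by lia.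
have hG := gauss_binom_mul_succ; have hN := card_line_mul_succ.
rewrite !qintS // -/x in hG hN.
rewrite natz mulrDl.
have -> : #|line V|%:Z * (q%:Z + 1) =
  ((1 + q * (1 + q * (1 + q * x))) * (1 + q * (1 + q * x)))%N%:Z.
  by rewrite -hN PoszM PoszD.
have -> : (q ^ 4 * G)%N%:Z * (q%:Z + 1) = (q ^ 4 * ((1 + q * x) * x))%N%:Z.
  by rewrite -hG !PoszM PoszD; ring.
rewrite !(PoszM, PoszD); ring.
Qed.

Lemma dvd_count0 : dvd_count d (l ^ 0)%N = #|line V|.
Proof.
apply: etrans (card_ord _); apply: eq_card => j.
by rewrite !inE expn0 dvd1z.
Qed.

(** The disjunction concerns powers dividing [x] but not [G]: the value [n] - 1 is established for l
    dividing q + 1, and the other alternative excludes such powers. *)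
Lemma dvd_count_skew_lines i : (0 < i)%N ->
  (l %| q + 1)%N || (logn l x <= logn l G)%N ->
  dvd_count d (l ^ i)%N =
  if (i <= logn l x)%N then
    if (i <= logn l G)%N then qint q r.+3 else (qint q r.+3 - 1)%N
  else if (i <= logn l G)%N then 1%N else 0%N.
Proof.
move=> i0 lq1; have dA' := dA; rewrite skew_lines_mxE in dA'.
have cs := @incidence_col_sum F V.
have n1 : (qint q r.+2)%:Z = 1 + q%:Z * (1 + q%:Z * x%:Z).
  by rewrite !qintS // !(PoszD, PoszM).
have rs i' : \sum_j incidence_mx V i' j = 1 + q%:Z * (1 + q%:Z * x%:Z).
  by rewrite incidence_row_sum dimV.
have mm := incidence_mul_tr V; rewrite dimV /= n1 addrAC subrr add0r in mm.
have lQ : ~~ (l%:Z %| q%:Z)%Z by [].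
have m0 : (0 < #|point V|)%N by rewrite card_point dimV qint_gt0.
have N0 : (0 < #|line V|)%N.
  by apply: leq_trans card_line_ge; apply: qint_gt0.
have cE : ((l ^ i)%N%:Z %| q%:Z ^+ 2 * x%:Z)%Z = (i <= logn l x)%N.
  rewrite dvdzE abszM abszX /= Gauss_dvdr ?pfactor_dvdn ?qint_gt0 //.
  by rewrite coprimeXl // coprimeXr // prime_coprime.
have kE : ((l ^ i)%N%:Z %| q%:Z - (1 + q%:Z * (1 + q%:Z * x%:Z)) * (q%:Z + 1)
    + #|line V|%:R)%Z = (i <= logn l G)%N.
  rewrite skew_lines_valency dvdzE /= Gauss_dvdr.
    by rewrite pfactor_dvdn ?gauss_binom_gt0.
  by rewrite coprimeXl // coprimeXr // prime_coprime.
have mE : #|point V| = qint q r.+3 by rewrite card_point dimV.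
case: leqP => ic; case: leqP => ik.
- by rewrite (dvd_count_11 cs rs mm lP lQ i0 dA') ?cE ?kE.
- have lQ1 : (l%:Z %| q%:Z + 1)%Z.
    case/orP: lq1 => [//|ck].
    by rewrite leqNgt (leq_trans ik) // in ck.
  by rewrite (dvd_count_10 cs rs mm lP lQ i0 dA') ?cE ?kE -?ltnNge // mE subn1.
- by rewrite (dvd_count_01 cs rs mm lP lQ i0 dA') ?cE ?kE -?ltnNge.
- by rewrite (dvd_count_00 cs rs mm lP lQ i0 dA') ?cE ?kE -?ltnNge.
Qed.

End SkewLines.

(** * From divisibility counts to multiplicities *)

Local Open Scope nat_scope.

(** The count is c + N at 0, c from 1 to [a], and 0 beyond, so it drops only after 0 and after [a].
    The shift to [i.+1] turns i + 1 <= a into i < a. *)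
Lemma mult_one_step (e k : nat -> nat) N c a :
  (forall i, e i + k i.+1 = k i) -> k 0 = c + N -> 0 < a ->
  (forall i, k i.+1 = if i < a then c else 0) ->
  [/\ e a = c, e 0 = N & forall i, i <> a -> i <> 0 -> e i = 0].
Proof.
move=> ek k0; case: a => // a _ hk; split=> [||[//|i] ia _].
- by have := ek a.+1; rewrite !hk ltnn ltnSn addn0.
- by apply/(@addIn c); rewrite addnC [RHS]addnC -k0 -ek hk addnC.
- have := ek i.+1; rewrite !hk !ltnS; case: ltngtP ia => [ia|ia|->] //= _.
    by rewrite -[RHS]add0n => /addIn.
  by rewrite addn0.
Qed.

Lemma mult_two_steps (e k : nat -> nat) N c a b :
  (forall i, e i + k i.+1 = k i) -> k 0 = c + 1 + N -> 0 < b < a ->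
  (forall i, k i.+1 = if i < a then if i < b then c + 1 else c else 0) ->
  [/\ e a = c, e b = 1, e 0 = N &
      forall i, i <> a -> i <> b -> i <> 0 -> e i = 0].
Proof.
move=> ek k0; case: b => //= b; case: a => // a; rewrite ltnS => ba hk.
split=> [|||[//|i] ia ib _].
- by have := ek a.+1; rewrite !hk ltnn ltnSn ltnS leqNgt ba addn0.
- have := ek b.+1; rewrite !hk ltnn ltnSn !ltnS ba ltnW //.
  by rewrite [c + 1]addnC => /addIn.
- apply/(@addIn (c + 1)); rewrite addnC [RHS]addnC -k0 -ek hk /=.
  by rewrite addnC.
- have := ek i.+1; rewrite !hk !ltnS.
  case: (ltngtP i a) ia => [ia|ia|->] //= _; last by rewrite addn0.
  by case: (ltngtP i b) ib => [ib|ib|->] //= _; rewrite -[RHS]add0n => /addIn.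
Qed.

Theorem mainTheorem8 (p t q n l : nat) (F : finFieldType) (V : vectType F)
    (p_prime : prime p) (t_ge1 : 1 <= t) (q_def : q = p ^ t)
    (card_F : #|F| = q) (n_ge4 : 4 <= n) (dim_V : \dim (fullv : {vspace V}) = n)
    (l_prime : prime l) (l_neq_p : l <> p)
    (d : 'rV[int]_(#|line V|))
    (d_smith : smith_diag (skew_lines_mx V) d) :
  let e := elementary_mult d l in
  let f := qint q n - 1 in
  let g := gauss_binom F n 2 - qint q n in
  let S_order := smith_group_order (skew_lines_mx V) in
  (~~ (l %| q + 1) ->
    [/\ ~~ (l %| qint q (n - 2)) -> ~~ (l %| qint q (n - 3)) ->
          ~~ (l %| S_order) /\ (forall i, i <> 0 -> e i = 0),
        l %| qint q (n - 2) -> ~~ (l %| qint q (n - 3)) ->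
          let a := logn l (gauss_binom F (n - 2) 2) in
          [/\ e a = 1, e 0 = f + g & forall i, i <> a -> i <> 0 -> e i = 0]
      & ~~ (l %| qint q (n - 2)) -> l %| qint q (n - 3) ->
          let a := logn l (qint q (n - 3)) in
          [/\ e a = f + 1, e 0 = g & forall i, i <> a -> i <> 0 -> e i = 0]])
  /\
  (l %| q + 1 ->
    [/\ l %| qint q (n - 2) -> ~~ (l %| qint (q ^ 2) ((n - 2) %/ 2)) ->
          [/\ ~~ odd n, ~~ (l %| S_order) & forall i, i <> 0 -> e i = 0],
        l %| qint q (n - 2) -> l %| qint (q ^ 2) ((n - 2) %/ 2) ->
          let a := logn l (gauss_binom F (n - 2) 2) in
          [/\ ~~ odd n, e a = 1, e 0 = f + g
            & forall i, i <> a -> i <> 0 -> e i = 0],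
        l %| qint q (n - 3) -> ~~ (l %| qint (q ^ 2) ((n - 3) %/ 2)) ->
          let a := logn l (qint q (n - 3)) in
          [/\ odd n, e a = f, e 0 = g + 1
            & forall i, i <> a -> i <> 0 -> e i = 0]
      & l %| qint q (n - 3) -> l %| qint (q ^ 2) ((n - 3) %/ 2) ->
          let a := logn l (q + 1) in
          let b := logn l (qint q (n - 3) %/ (q + 1)) in
          [/\ odd n, e (a + b) = f, e b = 1 & e 0 = g
            /\ forall i, i <> a + b -> i <> b -> i <> 0 -> e i = 0]]).
Proof.

have qF : #|F| = q by [].
have q_gt1 : 1 < q by rewrite -qF card_finNzRing_gt1.
have lq : ~~ (l %| q).
  rewrite q_def Euclid_dvdX // negb_and; apply/orP; left.
  by rewrite dvdn_prime2 //; apply/eqP.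
(* This makes every truncated subtraction compute; the parameter of the general lemmas, n - 3,
   becomes [r.+1]. *)
have [r nE] : exists r, n = r.+4 by exists (n - 4); rewrite -addn4 subnK.
rewrite {}nE in n_ge4 dim_V *; move=> e f g S_order.
set x := qint q (r.+4 - 3); set G := gauss_binom F (r.+4 - 2) 2.
have xE : x = qint q r.+1 by rewrite /x subSS subSS subSS subn0.
have GE : G = gauss_binom F r.+2 2 by rewrite /G subSS subSS subn0.
have dimV : \dim (fullv : {vspace V}) = r.+4 by [].
have x_gt0 : 0 < x by rewrite xE -qF qint_gt0.
have G_gt0 : 0 < G by rewrite GE (@gauss_binom_gt0 F r.+1).
have lq' : ~~ (l %| #|F|) by rewrite qF.
have eG : G * (q + 1) = (1 + q * x) * x.
  by rewrite GE -qF gauss_binom2 qF [in LHS]qintS // -xE.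
have wE : qint q (r.+4 - 2) = 1 + q * x.
  by rewrite xE -qintS // subSS subSS subn0.
have Ng : #|line V| = f + g + 1.
  have := card_line_ge dimV; rewrite qF => Nm.
  have Gn : gauss_binom F r.+4 2 = #|line V|.
    have := card_line_mul_succ dimV; have := gauss_binom2 F r.+4.
    by rewrite qF => <- /eqP; rewrite eqn_pmul2r ?addn1 // => /eqP.
  rewrite /g /f Gn; have : 0 < qint q r.+4 by rewrite -qF qint_gt0.
  by move: Nm; clear; lia.
have mE : qint q r.+4 = f + 1.
  by rewrite /f subnK // -qF qint_gt0.
(* From here [k i] is the number kappa_i, no longer the valency. *)
pose k i := dvd_count d (l ^ i)%N.
have ek i : e i + k i.+1 = k i by apply: elementary_mult_dvd_count.
have k0 : k 0 = f + g + 1 by rewrite -Ng; apply: dvd_count0.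
have kS i : (l %| q + 1) || (logn l x <= logn l G) -> k i.+1 =
  if i < logn l x then if i < logn l G then f + 1 else f
  else if i < logn l G then 1 else 0.
  move=> h; rewrite /k (dvd_count_skew_lines dimV _ l_prime lq' d_smith) //.
    by rewrite qF -[qint q r.+1]xE -GE mE addnK.
  by rewrite qF -[qint q r.+1]xE -GE.
have So : k 1 = 0 -> ~~ (l %| S_order).
  by move=> k1; apply: smith_group_order_prime d_smith _; rewrite // -[l]expn1.
(* One of [n-2] and [n-3], according to the parity of n, has an even index and splits off the factor
   q + 1. *)
have ev : ~~ odd r.+4 -> 1 + q * x = (q + 1) * qint (q ^ 2) ((r.+4 - 2) %/ 2).
  move=> od; rewrite -wE -qint_double // divn2 even_halfK //.
  by rewrite oddB // addbF.
have od : odd r.+4 -> x = (q + 1) * qint (q ^ 2) ((r.+4 - 3) %/ 2).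
  move=> od; rewrite /x -qint_double // divn2 even_halfK //.
  by rewrite oddB // od.
(* What remains is arithmetic of l-adic valuations. *)
clearbody k x G e g f S_order; clear d_smith d.
have vG : logn l G + logn l (q + 1) = logn l (1 + q * x) + logn l x.
  by rewrite -lognM ?addn_gt0 ?orbT // eG lognM.
have lE m : 0 < m -> (l %| m) = (0 < logn l m).
  by move=> m0; rewrite -[l in LHS]expn1 pfactor_dvdn.
have w_gt0 : 0 < 1 + q * x by [].
(* [n-2] = 1 + q [n-3], so l cannot divide both. *)
have cop : l %| x -> ~~ (l %| 1 + q * x).
  move=> lx; rewrite addnC dvdn_addr ?dvdn_mull //.
  by rewrite dvdn1; apply: contraTneq l_prime => ->.
have e0 : (forall j, k j.+1 = 0) -> forall i, i <> 0 -> e i = 0.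
  by move=> kz [//|i] _; have := ek i.+1; rewrite !kz addn0.
move: (qint _ ((r.+4 - 2) %/ 2)) ev => y2 ev.
move: (qint _ ((r.+4 - 3) %/ 2)) od => y3 od.
rewrite wE.
have l0 m : 0 < m -> ~~ (l %| m) -> logn l m = 0.
  by move=> m0; rewrite lE // lt0n negbK => /eqP.
have q1_gt0 : 0 < q + 1 by rewrite addn1.
clear wE xE GE mE lq' Ng qF dimV.
clear p t p_prime t_ge1 l_neq_p q_def F V card_F n_ge4 dim_V.
split=> [lq1|lq1].
  (* As l does not divide q + 1, the valuation of [G] is at least that of [x], which is the second
     alternative required by [kS]. *)
  have {}vG : logn l G = logn l (1 + q * x) + logn l x.
    by rewrite -vG (l0 (q + 1)) ?addn0.
  have hk i : k i.+1 = if i < logn l x then f + 1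
                       else if i < logn l G then 1 else 0.
    have le : logn l x <= logn l G by rewrite vG leq_addl.
    by rewrite kS ?le ?orbT //; case: ltnP => // ix; rewrite (leq_trans ix le).
  split=> [lw lx|lw lx|lw lx].
  - have kz i : k i.+1 = 0 by rewrite hk vG !l0.
    by split; [apply: So; apply: kz | apply: e0].
  - apply: mult_one_step ek _ _ _; first by rewrite k0 addnC.
      by rewrite vG (l0 x) // addn0 -lE.
    by move=> i; rewrite hk (l0 x).
  - apply: mult_one_step ek _ _ _; first by rewrite k0 addnAC.
      by rewrite -lE.
    by move=> i; rewrite hk vG (l0 (1 + _)) //; case: ltnP.
have hk i := kS i (introT orP (or_introl lq1)).
have lwx : l %| 1 + q * x -> ~~ (l %| x) by move=> lw; apply: contraL lw.
(* Parity is forced: for the opposite parity q + 1, hence l, would divide the other of [n-2] and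
   [n-3]. *)
have nw : l %| 1 + q * x -> ~~ odd r.+4.
  by move=> /lwx; apply: contra => /od ->; apply: dvdn_mulr.
have nx : l %| x -> odd r.+4.
  by move=> /cop; apply: contraR => /ev ->; apply: dvdn_mulr.
(* Cancelling q + 1 in [eG] leaves the q^2-integer as a factor of [G]. *)
have GE2 : ~~ odd r.+4 -> G = y2 * x.
  move=> /ev eV; apply/eqP.
  by rewrite -(eqn_pmul2r q1_gt0) eG eV [eqbRHS]mulnC mulnA.
have GE3 : odd r.+4 -> G = (1 + q * x) * y3.
  move=> /od eV; apply/eqP; rewrite -(eqn_pmul2r q1_gt0) eG.
  by rewrite [X in _ * X == _]eV [(q + 1) * y3]mulnC mulnA.
split=> [lw ly|lw ly|lx ly|lx ly].
- have vx : logn l x = 0 by rewrite l0 ?lwx.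
  have y2_gt0 : 0 < y2 by move: G_gt0; rewrite GE2 ?nw // muln_gt0 => /andP[].
  have vG0 : logn l G = 0 by rewrite GE2 ?nw // lognM // vx l0.
  have kz i : k i.+1 = 0 by rewrite hk vx vG0.
  by split; [apply: nw | apply: So; apply: kz | apply: e0].
- have vx : logn l x = 0 by rewrite l0 ?lwx.
  have lG : 0 < logn l G by rewrite -lE // GE2 ?nw // dvdn_mulr.
  have [] := @mult_one_step e k (f + g) 1 (logn l G) ek _ lG _.
  + by rewrite k0 addnC.
  + by move=> i; rewrite hk vx.
  + by move=> ? ? ?; split; [apply: nw | ..].
- have vG0 : logn l G = 0.
    have y3_gt0 : 0 < y3.
      by move: G_gt0; rewrite GE3 ?nx // muln_gt0 => /andP[].
    by rewrite GE3 ?nx // lognM // !l0 ?cop.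
  have lx0 : 0 < logn l x by rewrite -lE.
  have [] := @mult_one_step e k (g + 1) f (logn l x) ek _ lx0 _.
  + by rewrite k0 addnA.
  + by move=> i; rewrite hk vG0; case: ltnP.
  + by move=> ? ? ?; split; [apply: nx | ..].
- have y3_gt0 : 0 < y3.
    by move: G_gt0; rewrite GE3 ?nx // muln_gt0 => /andP[].
  have xq : x %/ (q + 1) = y3 by rewrite od ?nx // mulKn.
  have vx : logn l x = logn l (q + 1) + logn l y3.
    by rewrite [in LHS]od ?nx // lognM.
  have vGy : logn l G = logn l y3 by rewrite GE3 ?nx // lognM // l0 ?cop.
  have y3l : 0 < logn l y3 by rewrite -lE.
  (* The two drops, at the valuations of [G] and of [x], are distinct because l divides q + 1. *)
  have lt_y3 : 0 < logn l y3 < logn l x.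
    by rewrite y3l vx -[X in X < _]add0n ltn_add2r -lE.
  move=> a b; rewrite /a /b xq -vx.
  have [] := @mult_two_steps e k g f (logn l x) (logn l y3) ek _ lt_y3 _.
  + by rewrite k0 addnAC.
  + move=> i; rewrite hk vGy; case: ltnP => // ix.
    case/andP: lt_y3 => _ /ltnW y3x.
    by rewrite ltnNge (leq_trans y3x ix).
  + by move=> ? ? ? ?; split; [apply: nx | .. | split].
Qed.
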